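(* Let $\mathcal{E}$ be an elementary topos and $j$ a local operator on $\mathcal{E}$. Given a subterminal object $U$ in $\mathbf{sh}_j(\mathcal{E})$, the open (resp. quasi-closed) local operator $o^{\mathbf{sh}_j(\mathcal{E})}(U)$ (resp. $qc^{\mathbf{sh}_j(\mathcal{E})}(U)$) on $\mathbf{sh}_j(\mathcal{E})$ associated to $U$ is the relativization at $j$ of the open (resp. quasi-closed) local operator $o^{\mathcal{E}}(U)$ (resp. $qc^{\mathcal{E}}(U)$) on $\mathcal{E}$ associated to $U$ (regarded as a subterminal object of $\mathcal{E}$).
   Context: $\Omega$ is the subobject classifier of $\mathcal{E}$, and $e_j:\Omega_j\rightarrowtail\Omega$ is the equalizer of $1_\Omega,j:\Omega\to\Omega$; $\Omega_j$ is the subobject classifier of the topos $\mathbf{sh}_j(\mathcal{E})$ of $j$-sheaves. A local operator $k':\Omega_j\to\Omega_j$ on $\mathbf{sh}_j(\mathcal{E})$ is the relativization at $j$ of a local operator $k$ on $\mathcal{E}$ if $e_j\circ k'=k\circ e_j$. For a subterminal object $U$ of a topos $\mathcal{E}$ with classifying map $u:1\to\Omega$ and $\Rightarrow:\Omega\times\Omega\to\Omega$ the internal Heyting implication, $o^{\mathcal{E}}(U)$ is the composite $\Omega\cong 1\times\Omega\xrightarrow{u\times 1}\Omega\times\Omega\xrightarrow{\Rightarrow}\Omega$ (i.e. $p\mapsto(u\Rightarrow p)$), and $qc^{\mathcal{E}}(U)$ is the composite $\Omega\cong\Omega\times 1\xrightarrow{1\times(u,u)}\Omega\times\Omega\times\Omega\xrightarrow{\Rightarrow\times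 1}\Omega\times\Omega\xrightarrow{\Rightarrow}\Omega$ (i.e. $p\mapsto((p\Rightarrow u)\Rightarrow u)$). *)

(* Defs.v *)
From Stdlib Require Import Setoid ssreflect.

Set Implicit Arguments.
Unset Strict Implicit.
Unset Printing Implicit Defensive.

Declare Scope topos_scope.
Delimit Scope topos_scope with topos.
Local Open Scope topos_scope.

Record category := Category {
  ob :> Type;
  hom : ob -> ob -> Type;
  idm : forall A, hom A A;
  comp : forall A B C, hom B C -> hom A B -> hom A C;
  compIf : forall A B (f : hom A B), comp (idm B) f = f;
  compfI : forall A B (f : hom A B), comp f (idm A) = f;
  compA : forall A B C D (h : hom C D) (g : hom B C) (f : hom A B),
    comp h (comp g f) = comp (comp h g) f
}.

Arguments idm {c} A.
Notation "A ~> B" := (hom A B) (at level 70, no associativity) : topos_scope.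
Notation "g '\c' f" := (comp g f) (at level 40, left associativity)
  : topos_scope.

Definition mono (C : category) (A B : C) (m : A ~> B) : Prop :=
  forall X (f g : X ~> A), m \c f = m \c g -> f = g.

Definition is_pullback (C : category) (A B D P : C)
    (f : A ~> D) (g : B ~> D) (p : P ~> A) (q : P ~> B) : Prop :=
  f \c p = g \c q /\
  forall X (a : X ~> A) (b : X ~> B), f \c a = g \c b ->
    exists! h : X ~> P, p \c h = a /\ q \c h = b.

(* Finite limits are given by a terminal object, binary products and
   equalizers; all the structure is chosen. *)
Record topos := Topos {
  cat :> category;

  one : cat;
  bang : forall A : cat, A ~> one;
  bang_uniq : forall (A : cat) (f g : A ~> one), f = g;

  prod : cat -> cat -> cat;
  pr1 : forall A B, prod A B ~> A;
  pr2 : forall A B, prod A B ~> B;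
  pair : forall X A B, X ~> A -> X ~> B -> X ~> prod A B;
  pr1_pair : forall X A B (f : X ~> A) (g : X ~> B), pr1 A B \c pair f g = f;
  pr2_pair : forall X A B (f : X ~> A) (g : X ~> B), pr2 A B \c pair f g = g;
  pair_uniq : forall X A B (h : X ~> prod A B),
    h = pair (pr1 A B \c h) (pr2 A B \c h);

  eqz : forall A B : cat, A ~> B -> A ~> B -> cat;
  eqz_in : forall A B (f g : A ~> B), eqz f g ~> A;
  eqz_eq : forall A B (f g : A ~> B), f \c eqz_in f g = g \c eqz_in f g;
  eqz_lift : forall A B (f g : A ~> B) X (a : X ~> A),
    f \c a = g \c a -> X ~> eqz f g;
  eqz_liftE : forall A B (f g : A ~> B) X (a : X ~> A)
    (H : f \c a = g \c a), eqz_in f g \c eqz_lift H = a;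
  eqz_mono : forall A B (f g : A ~> B), mono (eqz_in f g);

  (* [expo A B] is the exponential B^A *)
  expo : cat -> cat -> cat;
  ev : forall A B, prod (expo A B) A ~> B;
  curry : forall X A B, prod X A ~> B -> X ~> expo A B;
  ev_curry : forall X A B (f : prod X A ~> B),
    ev A B \c pair (curry f \c pr1 X A) (pr2 X A) = f;
  curry_uniq : forall X A B (h : X ~> expo A B),
    h = curry (ev A B \c pair (h \c pr1 X A) (pr2 X A));

  Omega : cat;
  tru : one ~> Omega;
  char : forall A B (m : A ~> B), mono m -> B ~> Omega;
  char_pb : forall A B (m : A ~> B) (Hm : mono m),
    is_pullback (char Hm) tru m (bang A);
  char_uniq : forall A B (m : A ~> B) (Hm : mono m) (chi : B ~> Omega),
    is_pullback chi tru m (bang A) -> chi = char Hm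
}.

Arguments one {t}.
Arguments bang {t} A.
Arguments bang_uniq {t A} f g.
Arguments pr1 {t A B}.
Arguments pr2 {t A B}.
Arguments eqz_mono {t A B} f g.
Arguments ev {t A B}.
Arguments Omega {t}.
Arguments tru {t}.
Notation "A '\x' B" := (prod A B) (at level 40, left associativity)
  : topos_scope.

Definition prod_map {E : topos} {A B C D : E} (f : A ~> C) (g : B ~> D) :
  A \x B ~> C \x D := pair (f \c pr1) (g \c pr2).

Definition prod_assoc {E : topos} (A B C : E) :
  A \x (B \x C) ~> (A \x B) \x C :=
  pair (pair pr1 (pr1 \c pr2)) (pr2 \c pr2).

Definition ttrue {E : topos} (X : E) : X ~> Omega := tru \c bang X.

Lemma mono_one {E : topos} (A : E) (f : one ~> A) : mono f.
Proof. by move=> X g h _; apply: bang_uniq. Qed.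

Arguments mono_one {E A} f.

Definition meet {E : topos} : Omega \x Omega ~> @Omega E :=
  char (mono_one (pair (@tru E) tru)).

(* [impl] classifies the order relation of Omega, i.e. the equalizer of the
   conjunction and the first projection. *)
Definition impl {E : topos} : Omega \x Omega ~> @Omega E :=
  char (eqz_mono (@meet E) pr1).

Section KripkeJoyal.
Context {E : topos}.
Implicit Types X Y : E.

Lemma bangE X Y (f : X ~> Y) : bang Y \c f = bang X.
Proof. exact: bang_uniq. Qed.

Lemma ttE X Y (f : X ~> Y) : ttrue Y \c f = ttrue X.
Proof. by rewrite /ttrue -compA bangE. Qed.

Lemma pair_comp X Y (A B : E) (f : Y ~> A) (g : Y ~> B) (h : X ~> Y) :
  pair f g \c h = pair (f \c h) (g \c h).
Proof. by rewrite [LHS]pair_uniq !compA pr1_pair pr2_pair. Qed.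

Lemma prod_map_pair X (A B C D : E) (f : A ~> C) (g : B ~> D)
    (a : X ~> A) (b : X ~> B) :
  prod_map f g \c pair a b = pair (f \c a) (g \c b).
Proof. by rewrite /prod_map pair_comp -!compA pr1_pair pr2_pair. Qed.

Lemma prod_assoc_pair X (A B C : E) (a : X ~> A) (b : X ~> B) (c : X ~> C) :
  prod_assoc A B C \c pair a (pair b c) = pair (pair a b) c.
Proof.
by rewrite /prod_assoc !pair_comp -!compA !(pr1_pair, pr2_pair).
Qed.

Lemma char_ttP A B (m : A ~> B) (Hm : mono m) X (b : X ~> B) :
  char Hm \c b = ttrue X <-> exists a, m \c a = b.
Proof.
have [sq un] := char_pb Hm; split.
  by move=> /un [a [[Ha _] _]]; exists a.
by move=> [a <-]; rewrite compA sq -compA bangE.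
Qed.

Lemma char_uniq' A B (m : A ~> B) (Hm : mono m) (chi : B ~> Omega) :
  (forall X (b : X ~> B), chi \c b = ttrue X <-> exists a, m \c a = b) ->
  chi = char Hm.
Proof.
move=> H; apply: char_uniq; split.
  by apply/H; exists (idm A); rewrite compfI.
move=> X a b Hab.
have [c Hc] : exists c, m \c c = a.
  by apply/H; rewrite Hab (bang_uniq b (bang X)).
exists c; split; first by split=> //; exact: bang_uniq.
by move=> c' [Hc' _]; apply: Hm; rewrite Hc Hc'.
Qed.

Lemma omega_ext X (p q : X ~> Omega) :
  (forall Y (a : Y ~> X), p \c a = ttrue Y <-> q \c a = ttrue Y) -> p = q.
Proof.
move=> H.
have Hp Y (a : Y ~> X) :
    p \c a = ttrue Y <-> exists b, eqz_in p (ttrue X) \c b = a.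
  split=> [Ha|[b <-]].
    have Ha' : p \c a = ttrue X \c a by rewrite ttE.
    by exists (eqz_lift Ha'); rewrite eqz_liftE.
  by rewrite compA eqz_eq -compA ttE.
rewrite (char_uniq' (eqz_mono p (ttrue X)) Hp).
by symmetry; apply: char_uniq' => Y a; rewrite -H.
Qed.

Lemma meet_ttP X (p q : X ~> Omega) :
  meet \c pair p q = ttrue X <-> p = ttrue X /\ q = ttrue X.
Proof.
rewrite /meet char_ttP; split=> [[a]|[-> ->]].
  rewrite pair_comp (bang_uniq a (bang X)) => H; split.
    by rewrite -[p](pr1_pair p q) -H pr1_pair.
  by rewrite -[q](pr2_pair p q) -H pr2_pair.
by exists (bang X); rewrite pair_comp.
Qed.

Lemma impl_ttP X (p q : X ~> Omega) :
  impl \c pair p q = ttrue X <->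
  forall Y (a : Y ~> X), p \c a = ttrue Y -> q \c a = ttrue Y.
Proof.
have -> : impl \c pair p q = ttrue X <-> meet \c pair p q = p.
  rewrite /impl char_ttP; split=> [[a Ha]|H].
    by rewrite -Ha compA eqz_eq -compA Ha pr1_pair.
  have H' : meet \c pair p q = pr1 \c pair p q by rewrite pr1_pair.
  by exists (eqz_lift H'); rewrite eqz_liftE.
split=> [H Y a|H].
  by rewrite -{1}H -compA pair_comp meet_ttP => -[].
apply: omega_ext => Y a; rewrite -compA pair_comp meet_ttP.
by split=> [[]//|Ha]; split=> //; exact: H.
Qed.

End KripkeJoyal.

Record local_operator (E : topos) := LocalOperator {
  lop :> @Omega E ~> Omega;
  lop_true : lop \c tru = tru;
  lop_idem : lop \c lop = lop;
  lop_meet : lop \c meet = meet \c prod_map lop lop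
}.

Record subterminal (E : topos) := Subterminal {
  st_ob :> E;
  st_mono : mono (bang st_ob)
}.

Arguments st_mono {E} s.

Definition st_char {E : topos} (U : subterminal E) : one ~> @Omega E :=
  char (st_mono U).

Definition open_map (E : topos) (U : subterminal E) : @Omega E ~> Omega :=
  impl \c prod_map (st_char U) (idm Omega) \c pair (bang Omega) (idm Omega).

Definition qc_map (E : topos) (U : subterminal E) : @Omega E ~> Omega :=
  impl \c prod_map impl (idm Omega) \c prod_assoc Omega Omega Omega
    \c prod_map (idm Omega) (pair (st_char U) (st_char U))
    \c pair (idm Omega) (bang Omega).

Section OpenQuasiClosed.
Context {E : topos} (U : subterminal E).
Implicit Types X Y Z : E.

Let u X : X ~> Omega := st_char U \c bang X.

Lemma st_charE X Y (a : Y ~> X) : st_char U \c bang X \c a = u Y.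
Proof. by rewrite -compA bangE. Qed.

Lemma open_mapE X (p : X ~> Omega) : open_map U \c p = impl \c pair (u X) p.
Proof.
by rewrite /open_map -!compA (pair_comp _ _ p) prod_map_pair !compIf bangE.
Qed.

Lemma qc_mapE X (p : X ~> Omega) :
  qc_map U \c p = impl \c pair (impl \c pair p (u X)) (u X).
Proof.
rewrite /qc_map -!compA (pair_comp _ _ p) prod_map_pair !compIf bangE.
by rewrite (pair_comp _ _ (bang X)) prod_assoc_pair prod_map_pair compIf.
Qed.

Lemma open_ttP X (p : X ~> Omega) :
  open_map U \c p = ttrue X <-> forall Y (a : Y ~> X), u Y = ttrue Y -> p \c a = ttrue Y.
Proof.
by rewrite open_mapE impl_ttP; split=> H Y a; move: (H Y a); rewrite st_charE.
Qed.

Lemma qc_ttP X (p : X ~> Omega) :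
  qc_map U \c p = ttrue X <->
  forall Y (a : Y ~> X),
    (forall Z (b : Z ~> Y), p \c (a \c b) = ttrue Z -> u Z = ttrue Z) -> u Y = ttrue Y.
Proof.
have ih Y (a : Y ~> X) : impl \c pair p (u X) \c a = ttrue Y <->
    forall Z (b : Z ~> Y), p \c (a \c b) = ttrue Z -> u Z = ttrue Z.
  rewrite -compA pair_comp st_charE impl_ttP.
  by split=> H Z b; move: (H Z b); rewrite -compA st_charE.
rewrite qc_mapE impl_ttP.
by split=> H Y a; move: (H Y a); rewrite st_charE ih.
Qed.

Lemma tru_tt : @tru E = ttrue one.
Proof. by rewrite /ttrue (bang_uniq (bang one) (idm one)) compfI. Qed.

Lemma open_true : open_map U \c tru = tru.
Proof. by rewrite {2}tru_tt; apply/open_ttP => Y a _; rewrite tru_tt ttE. Qed.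

Lemma open_idem : open_map U \c open_map U = open_map U.
Proof.
apply: omega_ext => X p; rewrite -compA !open_ttP.
split=> H Y a uY.
  have /open_ttP/(_ Y (idm Y) uY) : open_map U \c (p \c a) = ttrue Y.
    by rewrite compA; exact: H.
  by rewrite compfI.
by rewrite -compA; apply/open_ttP => Z b uZ; rewrite -compA; exact: H.
Qed.

Lemma open_meet :
  open_map U \c meet = meet \c prod_map (open_map U) (open_map U).
Proof.
apply: omega_ext => X a; rewrite -!(compA _ _ a) [a]pair_uniq.
move: (pr1 \c a) (pr2 \c a) => p q.
rewrite prod_map_pair meet_ttP !open_ttP; split=> [H|[Hp Hq] Y b uY].
  by split=> Y b uY; move: (H Y b uY); rewrite -compA pair_comp meet_ttP => -[].
by rewrite -compA pair_comp meet_ttP; split; [exact: Hp|exact: Hq].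
Qed.

Lemma qc_true : qc_map U \c tru = tru.
Proof.
rewrite {2}tru_tt; apply/qc_ttP => Y a /(_ Y (idm Y)); apply.
by rewrite tru_tt ttE.
Qed.

Lemma qc_idem : qc_map U \c qc_map U = qc_map U.
Proof.
apply: omega_ext => X p; rewrite -(compA _ _ p) !qc_ttP.
split=> H Y a K; apply: (H Y a) => Z b.
  rewrite -(compA _ p) => /qc_ttP /(_ Z (idm Z)); apply=> W c.
  by rewrite compIf -(compA p) -(compA a); exact: K.
move=> pZ; apply: (K Z b); rewrite -(compA _ p); apply/qc_ttP => W c L.
by apply: (L W (idm W)); rewrite pZ ttE.
Qed.

Lemma qc_meet : qc_map U \c meet = meet \c prod_map (qc_map U) (qc_map U).
Proof.
apply: omega_ext => X a; rewrite -!(compA _ _ a) [a]pair_uniq.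
move: (pr1 \c a) (pr2 \c a) => p q.
rewrite prod_map_pair meet_ttP !qc_ttP; split=> [H|[Hp Hq] Y b K].
  by split=> Y b K; apply: (H Y b) => Z c;
    rewrite -(compA meet) pair_comp meet_ttP => -[? ?]; apply: (K Z c).
apply: (Hp Y b) => Z c pZ; apply: (Hq Z (b \c c)) => W d qW.
apply: (K W (c \c d)); rewrite -(compA meet) pair_comp meet_ttP; split.
  by rewrite !compA -(compA p) pZ ttE.
by rewrite (compA b).
Qed.

End OpenQuasiClosed.

Definition open_operator (E : topos) (U : subterminal E) : local_operator E :=
  LocalOperator (open_true U) (open_idem U) (open_meet U).

Definition qc_operator (E : topos) (U : subterminal E) : local_operator E :=
  LocalOperator (qc_true U) (qc_idem U) (qc_meet U).

Section Sheaves.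
Context {E : topos} (j : local_operator E).

(* A mono is dense when its [j]-closure, classified by [j \c char Hm], is the
   whole of [B]. *)
Definition dense (A B : E) (m : A ~> B) : Prop :=
  exists Hm : mono m, j \c char Hm = ttrue B.

Definition is_sheaf (F : E) : Prop :=
  forall (A B : E) (m : A ~> B), dense m ->
  forall f : A ~> F, exists! g : B ~> F, g \c m = f.

Definition Omega_j : E := eqz (idm Omega) j.
Definition e_j : Omega_j ~> Omega := eqz_in (idm Omega) j.

Record sheaf := Sheaf {
  sheaf_ob :> E;
  sheafP : is_sheaf sheaf_ob
}.

Arguments sheafP s : clear implicits.

Lemma sheaf_uniq (F A B : E) (m : A ~> B) (f g : B ~> F) :
  is_sheaf F -> dense m -> f \c m = g \c m -> f = g.
Proof.
move=> sF dm H; have [h [_ un]] := sF _ _ _ dm (g \c m).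
by rewrite -(un f H) -(un g).
Qed.

Lemma sheaf_ext (F A B : E) (m : A ~> B) (f : A ~> F) :
  is_sheaf F -> dense m -> exists g, g \c m = f.
Proof. by move=> sF dm; have [g []] := sF _ _ _ dm f; exists g. Qed.

Lemma sheafI (F : E) :
  (forall (A B : E) (m : A ~> B), dense m ->
    (forall f : A ~> F, exists g : B ~> F, g \c m = f) /\
    (forall f g : B ~> F, f \c m = g \c m -> f = g)) -> is_sheaf F.
Proof.
move=> H A B m /H [ex un] f; have [g Hg] := ex f.
by exists g; split=> // h Hh; apply: un; rewrite Hg Hh.
Qed.

Lemma one_sheaf : is_sheaf one.
Proof.
apply: sheafI => A B m _; split=> [f|f g _]; last exact: bang_uniq.
by exists (bang B); exact: bang_uniq.
Qed.

Lemma prod_sheaf (F G : E) : is_sheaf F -> is_sheaf G -> is_sheaf (F \x G).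
Proof.
move=> sF sG; apply: sheafI => A B m dm; split=> [f|f g H].
  have [a Ha] := sheaf_ext (pr1 \c f) sF dm.
  have [b Hb] := sheaf_ext (pr2 \c f) sG dm.
  by exists (pair a b); rewrite pair_comp Ha Hb -pair_uniq.
rewrite (pair_uniq f) (pair_uniq g); congr pair.
  by apply: (sheaf_uniq sF dm); rewrite -!compA H.
by apply: (sheaf_uniq sG dm); rewrite -!compA H.
Qed.

Lemma eqz_sheaf (F G : E) (f g : F ~> G) :
  is_sheaf F -> is_sheaf G -> is_sheaf (eqz f g).
Proof.
move=> sF sG; apply: sheafI => A B m dm; split=> [a|a b H].
  have [b Hb] := sheaf_ext (eqz_in f g \c a) sF dm.
  have H : f \c b = g \c b.
    by apply: (sheaf_uniq sG dm); rewrite -!compA Hb !compA eqz_eq.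
  by exists (eqz_lift H); apply: eqz_mono; rewrite compA eqz_liftE.
by apply: eqz_mono; apply: (sheaf_uniq sF dm); rewrite -!compA H.
Qed.

Lemma dense_prod (A B X : E) (m : A ~> B) :
  dense m -> dense (prod_map m (idm X)).
Proof.
move=> [Hm dm].
have Hmx : mono (prod_map m (idm X)).
  move=> Y f g; rewrite (pair_uniq f) (pair_uniq g) !prod_map_pair !compIf => H.
  congr pair; last by have := f_equal (comp pr2) H; rewrite !pr2_pair.
  by apply: (Hm); have := f_equal (comp pr1) H; rewrite !pr1_pair.
exists Hmx; suff <- : char Hm \c pr1 = char Hmx by rewrite compA dm ttE.
apply: char_uniq' => Y b; rewrite -compA char_ttP; split=> [[a Ha]|[a <-]].
  exists (pair a (pr2 \c b)).
  by rewrite prod_map_pair Ha compIf -pair_uniq.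
by exists (pr1 \c a); rewrite [in RHS](pair_uniq a) prod_map_pair pr1_pair.
Qed.

Lemma curry_inj (X A B : E) (f g : X ~> expo A B) :
  ev \c prod_map f (idm A) = ev \c prod_map g (idm A) -> f = g.
Proof.
by rewrite /prod_map !compIf => H; rewrite (curry_uniq f) H -curry_uniq.
Qed.

Lemma ev_curry' (X A B : E) (f : X \x A ~> B) :
  ev \c prod_map (curry f) (idm A) = f.
Proof. by rewrite /prod_map compIf ev_curry. Qed.

Lemma prod_mapM (A B C X : E) (g : B ~> C) (f : A ~> B) :
  prod_map (g \c f) (idm X) = prod_map g (idm X) \c prod_map f (idm X).
Proof. by rewrite {3}/prod_map prod_map_pair /prod_map !compIf compA. Qed.

Lemma expo_sheaf (X F : E) : is_sheaf F -> is_sheaf (expo X F).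
Proof.
move=> sF; apply: sheafI => A B m dm; have dmX := dense_prod X dm.
split=> [f|f g H].
  have [g Hg] := sheaf_ext (ev \c prod_map f (idm X)) sF dmX.
  by exists (curry g); apply: curry_inj; rewrite prod_mapM compA ev_curry'.
apply: curry_inj; apply: (sheaf_uniq sF dmX).
by rewrite -!compA -!prod_mapM H.
Qed.

Lemma lop_tt (X : E) : j \c ttrue X = ttrue X.
Proof. by rewrite /ttrue compA lop_true. Qed.

Lemma lop_pair (X : E) (p q : X ~> Omega) :
  j \c (meet \c pair p q) = meet \c pair (j \c p) (j \c q).
Proof. by rewrite compA lop_meet -compA prod_map_pair. Qed.

Lemma e_jP (X : E) (p : X ~> Omega) :
  j \c p = p <-> exists q : X ~> Omega_j, e_j \c q = p.
Proof.
split=> [H|[q <-]]; last by rewrite compA -eqz_eq compIf.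
have H' : idm Omega \c p = j \c p by rewrite compIf H.
by exists (eqz_lift H'); rewrite /e_j eqz_liftE.
Qed.

Lemma e_j_mono : mono e_j. Proof. exact: eqz_mono. Qed.

Lemma e_j_closed (X : E) (q : X ~> Omega_j) : j \c (e_j \c q) = e_j \c q.
Proof. by apply/e_jP; exists q. Qed.

Lemma Omega_j_sheaf : is_sheaf Omega_j.
Proof.
apply: sheafI => A B m [Hm dm]; split=> [f|f g H].
  pose s := eqz_in (e_j \c f) (ttrue A).
  have Hms : mono (m \c s).
    by move=> X a b; rewrite -!compA => /Hm /eqz_mono.
  have Hmf : char Hms \c m = e_j \c f.
    apply: omega_ext => Y a; rewrite -compA char_ttP; split=> [[b]|Ha].
      rewrite -compA => /Hm <-.
      by rewrite compA /s eqz_eq -compA ttE.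
    have Ha' : e_j \c f \c a = ttrue A \c a by rewrite ttE.
    by exists (eqz_lift Ha'); rewrite -compA eqz_liftE.
  have /e_jP [g Hg] : j \c (j \c char Hms) = j \c char Hms.
    by rewrite compA lop_idem.
  exists g; apply: e_j_mono.
  by rewrite compA Hg -compA Hmf e_j_closed.
apply: e_j_mono.
have K : meet \c pair (e_j \c f) (char Hm) = meet \c pair (e_j \c g) (char Hm).
  have Q Y (b : Y ~> A) : e_j \c f \c (m \c b) = e_j \c g \c (m \c b).
    by rewrite !compA -(compA e_j f) H (compA e_j g).
  apply: omega_ext => Y a.
  rewrite -!(compA meet) !(pair_comp _ _ a) !meet_ttP !char_ttP.
  by split=> -[Ha [b Hb]]; move: Ha; rewrite -Hb Q; split=> //; exists b.
have L (h : B ~> Omega_j) :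
    j \c (meet \c pair (e_j \c h) (char Hm)) = e_j \c h.
  rewrite lop_pair dm e_j_closed; apply: omega_ext => Y a.
  by rewrite -compA pair_comp meet_ttP ttE; split=> [[]|].
by rewrite -(L f) -(L g) K.
Qed.

Lemma lop_infl (X : E) (p : X ~> Omega) : p = ttrue X -> j \c p = ttrue X.
Proof. by move=> ->; exact: lop_tt. Qed.

Lemma subsheaf_closed (F G : E) (m : F ~> G) (Hm : mono m) :
  is_sheaf F -> is_sheaf G -> j \c char Hm = char Hm.
Proof.
move=> sF sG; pose c := eqz_in (j \c char Hm) (ttrue G).
have cE : j \c char Hm \c c = ttrue _ by rewrite eqz_eq ttE.
have Hi : j \c char Hm \c m = ttrue G \c m.
  rewrite ttE -compA; apply: lop_infl.
  by apply/char_ttP; exists (idm F); rewrite compfI.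
pose i := eqz_lift Hi; have iE : c \c i = m by exact: eqz_liftE.
have Mi : mono i by move=> X a b H; apply: (Hm); rewrite -iE -!compA H.
have di : dense i.
  exists Mi; suff <- : char Hm \c c = char Mi by rewrite compA.
  apply: char_uniq' => Y b; rewrite -compA char_ttP; split=> -[a Ha].
    by exists a; apply: eqz_mono; rewrite compA iE.
  by exists a; rewrite -Ha compA iE.
have [r Hr] := sheaf_ext (idm F) sF di.
have mr : m \c r = c.
  by apply: (sheaf_uniq sG di); rewrite -compA Hr compfI iE.
apply: omega_ext => Y a; split=> [Ha|/lop_infl]; last by rewrite compA.
have Ha' : j \c char Hm \c a = ttrue G \c a by rewrite ttE.
by apply/char_ttP; exists (r \c eqz_lift Ha'); rewrite compA mr eqz_liftE.
Qed.

Arguments prod_sheaf {F G} _ _.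
Arguments eqz_sheaf {F G} f g _ _.
Arguments expo_sheaf X {F} _.

Definition sh_cat : category := {|
  ob := sheaf;
  hom F G := sheaf_ob F ~> sheaf_ob G;
  idm F := idm (sheaf_ob F);
  comp F G H g f := g \c f;
  compIf F G f := compIf f;
  compfI F G f := compfI f;
  compA F G H K h g f := compA h g f
|}.

Definition sh_one : sh_cat := Sheaf one_sheaf.
Definition sh_prod (F G : sh_cat) : sh_cat :=
  Sheaf (prod_sheaf (sheafP F) (sheafP G)).
Definition sh_eqz (F G : sh_cat) (f g : F ~> G) : sh_cat :=
  Sheaf (eqz_sheaf f g (sheafP F) (sheafP G)).
Definition sh_expo (F G : sh_cat) : sh_cat :=
  Sheaf (expo_sheaf (sheaf_ob F) (sheafP G)).
Definition sh_Omega : sh_cat := Sheaf Omega_j_sheaf.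

Lemma tru_closed : idm Omega \c tru = j \c tru.
Proof. by rewrite compIf lop_true. Qed.

Definition sh_tru : sh_one ~> sh_Omega := eqz_lift tru_closed.

Lemma sh_truE : e_j \c sh_tru = tru.
Proof. exact: eqz_liftE. Qed.

(* The kernel pair of a map of sheaves is a sheaf. *)
Lemma sh_mono (F G : sh_cat) (m : F ~> G) :
  mono m -> @mono E (sheaf_ob F) (sheaf_ob G) m.
Proof.
move=> Hm X a b H; pose n : sheaf_ob F ~> sheaf_ob G := m.
pose K := @sh_eqz (sh_prod F F) G (n \c pr1) (n \c pr2).
pose k : sheaf_ob K ~> sheaf_ob F \x sheaf_ob F := eqz_in (n \c pr1) (n \c pr2).
have kE : pr1 \c k = pr2 \c k.
  by apply: (Hm K); rewrite /= !compA; exact: eqz_eq.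
have H' : n \c pr1 \c pair a b = n \c pr2 \c pair a b.
  by rewrite -!compA pr1_pair pr2_pair.
rewrite -(pr1_pair a b) -[in RHS](pr2_pair a b) -(eqz_liftE H') !compA.
by congr comp.
Qed.

Lemma sh_char_closed (F G : sh_cat) (m : F ~> G) (Hm : mono m) :
  idm Omega \c char (sh_mono Hm) = j \c char (sh_mono Hm).
Proof. by rewrite compIf subsheaf_closed //; exact: sheafP. Qed.

Definition sh_char (F G : sh_cat) (m : F ~> G) (Hm : mono m) : G ~> sh_Omega :=
  eqz_lift (sh_char_closed Hm).

Lemma sh_charE (F G : sh_cat) (m : F ~> G) (Hm : mono m) :
  e_j \c sh_char Hm = char (sh_mono Hm).
Proof. exact: eqz_liftE. Qed.

Definition sh_bang (F : sh_cat) : F ~> sh_one := bang (sheaf_ob F).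

Lemma sh_char_pb (F G : sh_cat) (m : F ~> G) (Hm : mono m) :
  is_pullback (sh_char Hm) sh_tru m (sh_bang F).
Proof.
have [sq un] := char_pb (sh_mono Hm); split.
  by apply: e_j_mono; rewrite /= !compA sh_charE sh_truE.
move=> X a b H; apply: un.
by rewrite -sh_charE -sh_truE -!compA; congr comp.
Qed.

Lemma sh_char_uniq (F G : sh_cat) (m : F ~> G) (Hm : mono m)
    (chi : G ~> sh_Omega) :
  is_pullback chi sh_tru m (sh_bang F) -> chi = sh_char Hm.
Proof.
move=> [sq un]; apply: e_j_mono; rewrite sh_charE.
apply: char_uniq' => Y b; split=> [H|[a <-]].
  pose x : sheaf_ob G ~> Omega_j := chi.
  pose t : sheaf_ob G ~> Omega_j := sh_tru \c sh_bang G.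
  pose P := @sh_eqz G sh_Omega x t.
  have [h [[Hh _] _]] : exists! h : P ~> F,
      m \c h = (eqz_in x t : P ~> G) /\ sh_bang F \c h = sh_bang P.
    by apply: un; rewrite /= [LHS]eqz_eq /t /= -compA; congr comp; exact: bangE.
  have H' : x \c b = t \c b.
    by apply: e_j_mono; rewrite compA H /t /= !compA sh_truE [tru \c _]/(ttrue _) ttE.
  pose h' : sheaf_ob P ~> sheaf_ob F := h.
  by exists (h' \c eqz_lift H'); rewrite compA [_ \c h']Hh eqz_liftE.
rewrite compA -(compA e_j).
have -> : comp (c := E) chi m = sh_tru \c bang (sheaf_ob F) by exact: sq.
by rewrite compA sh_truE -compA bangE.
Qed.

Definition sh : topos := {|
  cat := sh_cat;
  one := sh_one;
  bang := sh_bang;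
  bang_uniq F f g := bang_uniq f g;
  prod := sh_prod;
  pr1 F G := @pr1 E F G;
  pr2 F G := @pr2 E F G;
  pair X F G f g := @pair E X F G f g;
  pr1_pair X F G f g := @pr1_pair E X F G f g;
  pr2_pair X F G f g := @pr2_pair E X F G f g;
  pair_uniq X F G h := @pair_uniq E X F G h;
  eqz := sh_eqz;
  eqz_in F G f g := @eqz_in E F G f g;
  eqz_eq F G f g := @eqz_eq E F G f g;
  eqz_lift F G f g X a H := @eqz_lift E F G f g X a H;
  eqz_liftE F G f g X a H := @eqz_liftE E F G f g X a H;
  eqz_mono F G f g X := @eqz_mono E F G f g X;
  expo := sh_expo;
  ev F G := @ev E F G;
  curry X F G f := @curry E X F G f;
  ev_curry X F G f := @ev_curry E X F G f;
  curry_uniq X F G h := @curry_uniq E X F G h;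
  Omega := sh_Omega;
  tru := sh_tru;
  char := sh_char;
  char_pb := sh_char_pb;
  char_uniq := sh_char_uniq
|}.

End Sheaves.

Arguments sh E j : clear implicits.

Arguments open_operator E U : clear implicits.
Arguments qc_operator E U : clear implicits.

Definition sh_subterminal {E : topos} {j : local_operator E}
    (U : subterminal (sh E j)) : subterminal E :=
  @Subterminal E (sheaf_ob (st_ob U)) (sh_mono (st_mono U)).

(* [k'] is a map in [sh E j], which is a full subcategory of [E]; the cast
   views it as a map of [E]. *)
Definition relativization {E : topos} (j : local_operator E)
    (k' : local_operator (sh E j)) (k : local_operator E) : Prop :=
  e_j j \c (lop k' : Omega_j j ~> Omega_j j) = lop k \c e_j j.

Arguments relativization {E} j k' k.

(* Main.v *)
From Stdlib Require Import ssreflect.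
Require Import Defs.

Set Implicit Arguments.
Unset Strict Implicit.
Unset Printing Implicit Defensive.

Local Open Scope topos_scope.

(** The inclusion [e_j] of Omega_j into Omega preserves meets and
    implications, because monos, products and equalizers of sheaves are
    computed in the ambient topos; and it sends the classifying map of a
    subterminal sheaf to its classifying map in the ambient topos. Both
    operators are built from these ingredients alone. *)

Lemma eqz_factorP (E : topos) (A B X : E) (f g : A ~> B) (b : X ~> A) :
  (exists a, eqz_in f g \c a = b) <-> f \c b = g \c b.
Proof.
split=> [[a <-]|H]; first by rewrite !compA eqz_eq.
by exists (eqz_lift H); rewrite eqz_liftE.
Qed.

Section SheafHeyting.
Context {E : topos} (j : local_operator E).

Let ej2 : Omega_j j \x Omega_j j ~> Omega \x Omega := prod_map (e_j j) (e_j j).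
(** Cast as maps of [E], so that they compose there with [e_j j]. *)
Let sh_meet : Omega_j j \x Omega_j j ~> Omega_j j := @meet (sh E j).
Let sh_impl : Omega_j j \x Omega_j j ~> Omega_j j := @impl (sh E j).

(** Both sides classify the point [(sh_tru, sh_tru)] in [E]: as [e_j j] is monic and sends [sh_tru]
    to [tru], a component is [sh_tru] exactly when its image is true. *)
Lemma e_j_meet : e_j j \c sh_meet = meet \c ej2.
Proof.
apply: (eq_trans (sh_charE (@mono_one (sh E j) _ (pair tru tru)))).
apply: omega_ext => Y b; rewrite char_ttP -compA (pair_uniq b) prod_map_pair.
have truE (a : Y ~> one) : e_j j \c ((sh_tru j : one ~> Omega_j j) \c a) = ttrue Y.
  by rewrite compA sh_truE /ttrue (bang_uniq a (bang Y)).
rewrite meet_ttP; split=> [[a]|[H1 H2]].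
  rewrite [LHS]pair_comp => H.
  have /= H1 := f_equal (comp pr1) H; have /= H2 := f_equal (comp pr2) H.
  move: H1 H2; rewrite !pr1_pair !pr2_pair => <- <-.
  by rewrite !truE.
exists (bang Y); rewrite [LHS]pair_comp.
by congr pair; apply: (@e_j_mono E j); rewrite ?H1 ?H2 truE.
Qed.

(** Both sides classify the locus where meet equals the first projection, since the monic [e_j j]
    preserves meets and reflects equalities. *)
Lemma e_j_impl : e_j j \c sh_impl = impl \c ej2.
Proof.
apply: (eq_trans (sh_charE (@eqz_mono (sh E j) _ _ meet pr1))).
apply: omega_ext => Y b; rewrite -compA !char_ttP !eqz_factorP.
rewrite !compA -e_j_meet pr1_pair -!compA.
by split=> [H|/(@e_j_mono E j)//]; congr comp.
Qed.

Lemma e_j_impl_pair (X : E) (p q : X ~> Omega_j j) :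
  e_j j \c (sh_impl \c pair p q) = impl \c pair (e_j j \c p) (e_j j \c q).
Proof. by rewrite compA e_j_impl -compA prod_map_pair. Qed.

Lemma e_j_st_char (U : subterminal (sh E j)) (X : E) :
  e_j j \c ((st_char U : one ~> Omega_j j) \c bang X)
  = st_char (sh_subterminal U) \c bang X.
Proof. by rewrite compA; congr comp; exact: (sh_charE (st_mono U)). Qed.

End SheafHeyting.

Theorem proposition6p8 (E : topos) (j : local_operator E)
    (U : subterminal (sh E j)) :
  relativization j (open_operator (sh E j) U)
                   (open_operator E (sh_subterminal U)) /\
  relativization j (qc_operator (sh E j) U)
                   (qc_operator E (sh_subterminal U)).
Proof.
split; rewrite /relativization /=.
  (* The inserted identity is the generic element of [Omega_j]; the right side is evaluated at its
     image [e_j j]. *)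
  rewrite open_mapE -(compfI (open_map U)) (@open_mapE (sh E j)).
  rewrite [LHS]e_j_impl_pair; congr (_ \c pair _ _); last exact: compfI.
  exact: e_j_st_char.
rewrite qc_mapE -(compfI (qc_map U)) (@qc_mapE (sh E j)).
rewrite [LHS]e_j_impl_pair; congr (_ \c pair _ _); last exact: e_j_st_char.
rewrite [LHS]e_j_impl_pair; congr (_ \c pair _ _); first exact: compfI.
exact: e_j_st_char.
Qed.
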